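(* Let $G=(V,E)$ be an arbitrary graph with maximum degree $\Delta$. One can construct in polynomial time a triangle-free graph $\widehat G$ such that $\mathrm{rel\text{-}IS}(\widehat G)=\mathrm{rel\text{-}IS}(G)$.
   Context: For a graph $G=(V,E)$, $\mathrm{IS}(G)$ is the size of a maximum independent set and $\mathrm{rel\text{-}IS}(G)=\mathrm{IS}(G)/|V|$. A graph is triangle-free if it contains no cycle of length 3. *)

(* Defs.v *)
From mathcomp Require Import all_boot all_order all_algebra.

Set Implicit Arguments.
Unset Strict Implicit.
Unset Printing Implicit Defensive.

Import GRing.Theory.

Record graph := Graph {
  vertex :> finType;
  adj : rel vertex;
  adj_sym : symmetric adj;
  adj_irr : irreflexive adj }.

Definition max_degree (G : graph) : nat :=
  \max_(v : G) #|[set u : G | adj v u]|.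

Definition independent (G : graph) (S : {set G}) : bool :=
  [forall u in S, forall v in S, ~~ adj u v].

Definition IS (G : graph) : nat :=
  \max_(S : {set G} | independent S) #|S|.

(* For the graph without vertices this is 0 / 0, which is 0 in rat. *)
Definition rel_IS (G : graph) : rat := ((IS G)%:R / #|G|%:R)%R.

Definition triangle_free (G : graph) : Prop :=
  ~ exists s : seq G, ucycle (@adj G) s /\ size s = 3.

(* The random access machine of Cook and Reckhow: registers X_0, X_1, ...     *)
(* hold natural numbers and are initially 0, the input is read from, and the  *)
(* output printed to, one-way tapes.  There is no multiplication, so that     *)
(* the numbers gain at most one bit per step, and a polynomial number of      *)
(* steps is polynomial time in the Turing machine sense.                      *)
Variant instr :=
  | IConst of nat & nat         (* X_i <- c            *)
  | IAdd of nat & nat & nat     (* X_i <- X_j + X_k    *)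
  | ISub of nat & nat & nat     (* X_i <- X_j - X_k, truncated at 0 *)
  | ILoad of nat & nat          (* X_i <- X_(X_j)      *)
  | IStore of nat & nat         (* X_(X_i) <- X_j      *)
  | IJumpPos of nat & nat       (* go to line m if X_j > 0 *)
  | IRead of nat                (* X_i <- next input, 0 if there is none *)
  | IPrint of nat.

Definition program := seq instr.

Record config := Config {
  pc : nat;
  reg : nat -> nat;
  inp : seq nat;
  out : seq nat }.

Definition set_reg (c : config) (i x : nat) : config :=
  Config (pc c).+1 [eta reg c with i |-> x] (inp c) (out c).

Definition exec (a : instr) (c : config) : config :=
  let X := reg c in
  match a with
  | IConst i n => set_reg c i n
  | IAdd i j k => set_reg c i (X j + X k)
  | ISub i j k => set_reg c i (X j - X k)
  | ILoad i j => set_reg c i (X (X j))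
  | IStore i j => set_reg c (X i) (X j)
  | IJumpPos m j => Config (if 0 < X j then m else (pc c).+1) X (inp c) (out c)
  | IRead i => Config (pc c).+1 [eta X with i |-> head 0 (inp c)]
                (behead (inp c)) (out c)
  | IPrint i => Config (pc c).+1 X (inp c) (rcons (out c) (X i))
  end.

(* A machine whose program counter has left the program has halted. *)
Definition step (P : program) (c : config) : config :=
  if onth P (pc c) is Some a then exec a c else c.

Definition init_config (x : seq nat) : config := Config 0 (fun=> 0) x [::].

Definition halts_within (P : program) (x : seq nat) (t : nat) (y : seq nat) :=
  let c := iter t (step P) (init_config x) in size P <= pc c /\ out c = y.

(* The number of vertices, then the adjacency matrix in row-major order. *)
Definition encode (G : graph) : seq nat :=
  #|G| :: [seq nat_of_bool (adj u v) | u <- enum G, v <- enum G].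

(* The encoding of G has length #|G| ^ 2 + 1, so that being polynomial in     *)
(* #|G| is being polynomial in the size of the input.                         *)
Definition polytime (f : graph -> graph) : Prop :=
  exists (P : program) (p : {poly nat}), forall G : graph,
    halts_within P (encode G) (p.[#|G|])%R (encode (f G)).

(* Main.v *)
Require Import Defs.
From mathcomp Require Import all_boot all_order all_algebra.
From mathcomp Require Import zify ring.

(** Let n be the number of vertices of G, and p a prime with p >= n^2 + 4n + 8.  Order
V(G), blow every vertex up to a copy of F_p^2, and for each edge uv with u < v join
(u, x) to (v, y) when y - x = (t, t^2) with t <> 0.  A triangle would give
(s, s^2) + (t, t^2) = (s + t, (s + t)^2), hence 2 s t = 0.

Two points of F_p^2 have at most one common neighbour, so by Cauchy-Schwarz a set of
size a has at least q^2 a / (q + a) neighbours, where q = p - 1.  Given an independent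
set, call a vertex u of G heavy if the trace w(u) of the set on the copy over u has
n (q + w(u)) > q^2.  Heavy vertices are pairwise nonadjacent.  If every other vertex u
has a heavy neighbour v, then n w(u) <= p^2 - w(v), so the other traces together fit
into the room left over the heavy vertices; if some vertex has no heavy neighbour, it
can be added to the heavy ones, and all other traces together have size at most p^2.
In both cases the set has at most IS(G) p^2 elements.

For the running time, note that the values of an arithmetic expression built from sums
of the form sum_(k < a) b are bounded by polynomials in its inputs, and hence so is the
time to evaluate it on a random access machine.  Division, primality and the next prime
are such expressions, since the central binomial coefficient shows that there is a prime
between m and 2 m^2. *)

Set Implicit Arguments.
Unset Strict Implicit.
Unset Printing Implicit Defensive.

Import GRing.Theory.

(** * Primes in a polynomial range *)

Lemma sum_nat_ltn n c : \sum_(k < n) (k < c) = minn n c.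
Proof. by elim: n => [|n IHn]; rewrite ?big_ord0 ?big_ord_recr /= ?IHn; lia. Qed.

(* Legendre's formula: passing from [m] and [n - m] to [n] creates at most one
   carry for each power of [p] that is at most [n]. *)
Lemma logn_bin_leq p n m : prime p -> 0 < n -> m <= n ->
  logn p 'C(n, m) <= trunc_log p n.
Proof.
move=> p_pr n_gt0 le_mn; have p_gt1 := prime_gt1 p_pr.
pose legendre k := \sum_(1 <= i < n.+1) k %/ p ^ i.
have logn_fact_n k : k <= n -> logn p k`! = legendre k.
  move=> le_kn; rewrite logn_fact // /legendre.
  rewrite (big_cat_nat (n := k.+1) (p := n.+1)) //=.
  rewrite [X in _ + X]big1_seq ?addn0 // => i.
  rewrite mem_index_iota => /andP[_ /andP[lt_ki _]]; apply: divn_small.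
  exact: ltn_trans lt_ki (ltn_expl i p_gt1).
have sum_le_log : \sum_(1 <= i < n.+1) (i <= trunc_log p n) <= trunc_log p n.
  by rewrite big_add1 big_mkord sum_nat_ltn geq_minr.
have carries : legendre n <= legendre m + legendre (n - m) + trunc_log p n.
  rewrite -big_split /=; apply: leq_trans (leq_add (leqnn _) sum_le_log).
  rewrite -big_split; apply: leq_sum => i _ /=.
  have [_ | lt_log_i] := leqP i; first by rewrite -{1}(subnKC le_mn) leq_divDl.
  by rewrite divn_small // (leq_trans (trunc_log_ltn n p_gt1)) // leq_exp2l.
have := congr1 (logn p) (bin_fact le_mn).
rewrite !lognM ?muln_gt0 ?fact_gt0 ?bin_gt0 // !logn_fact_n ?leq_subr //.
by lia.
Qed.

Lemma pfactor_bin_leq p n m : prime p -> 0 < n -> m <= n ->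
  p ^ logn p 'C(n, m) <= n.
Proof.
move=> p_pr n_gt0 le_mn; have p_gt1 := prime_gt1 p_pr.
by apply: leq_trans (trunc_logP p_gt1 n_gt0); rewrite leq_exp2l ?logn_bin_leq.
Qed.

Lemma bin_leq_exp_primes n m M : 0 < n -> m <= n ->
  (forall p, prime p -> p <= n -> p < M) -> 'C(n, m) <= n ^ M.
Proof.
move=> n_gt0 le_mn lt_primes; have C_gt0 : 0 < 'C(n, m) by rewrite bin_gt0.
rewrite (prod_prime_decomp C_gt0) prime_decompE big_map /=.
apply: leq_trans (_ : \prod_(p <- primes 'C(n, m)) n <= _).
  rewrite big_seq [leqRHS]big_seq; apply: leq_prod => p.
  by rewrite mem_primes => /andP[p_pr _]; apply: pfactor_bin_leq.
rewrite big_const_seq count_predT iter_muln_1 leq_pexp2l // -(size_iota 0 M).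
apply: uniq_leq_size (primes_uniq _) _ => p p_dvd; rewrite mem_iota /= add0n.
have p_pr : prime p by move: p_dvd; rewrite mem_primes => /andP[].
apply: (lt_primes p p_pr); apply: leq_trans (pfactor_bin_leq p_pr n_gt0 le_mn).
by rewrite -{1}[p]expn1 leq_exp2l ?prime_gt1 // logn_gt0.
Qed.

Lemma exp2_leq_central_bin m : 2 ^ m <= 'C(m.*2, m).
Proof.
elim: m => // m IHm; have sym : 'C(m.*2.+1, m.+1) = 'C(m.*2.+1, m).
  by rewrite -bin_sub; [congr 'C(_, _); lia | lia].
rewrite doubleS expnS binS sym addnn -mul2n leq_mul2l /= -sym binS.
exact: leq_trans IHm (leq_addl _ _).
Qed.

Lemma double_sqrn_lt_exp2 M : 8 <= M -> (M ^ 2).*2 < 2 ^ M.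
Proof.
elim: M => // M IHM; rewrite leq_eqVlt => /predU1P[<- // | M_ge8].
by have := IHM M_ge8; rewrite [2 ^ M.+1]expnS -!mulnn -!mul2n; nia.
Qed.

(* Otherwise C(2 M^2, M^2) would be at most (2 M^2) ^ M, hence less than 2 ^ (M^2). *)
Lemma prime_between M : 8 <= M -> exists2 p, prime p & M <= p <= (M ^ 2).*2.
Proof.
move=> M_ge8; have M2_gt0 : 0 < M ^ 2 by rewrite expn_gt0; lia.
have [/existsP[p /andP[p_pr le_Mp]] | /existsPn no_prime] :=
    boolP [exists p : 'I_(M ^ 2).*2.+1, prime p && (M <= p)].
  by exists p; rewrite ?le_Mp //= -ltnS.
have lt_primes p : prime p -> p <= (M ^ 2).*2 -> p < M.
  move=> p_pr le_p; rewrite ltnNge; apply/negP => le_Mp.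
  by have := no_prime (Ordinal (le_p : p < _.+1)); rewrite /= p_pr le_Mp.
have leM2 : M ^ 2 <= (M ^ 2).*2 by rewrite -addnn leq_addr.
have := bin_leq_exp_primes _ leM2 lt_primes; rewrite double_gt0 => /(_ M2_gt0).
move/(leq_trans (exp2_leq_central_bin _)).
have -> : 2 ^ (M ^ 2) = (2 ^ M) ^ M by rewrite -expnM mulnn.
have M_gt0 : 0 < M by apply: leq_trans M_ge8.
by rewrite (leq_exp2r _ _ M_gt0) leqNgt double_sqrn_lt_exp2.
Qed.

Definition next_prime (m : nat) : nat :=
  m + find (fun k => prime (m + k)) (iota 0 (m ^ 2).*2.+1).

Lemma leq_next_prime m : m <= next_prime m.
Proof. exact: leq_addr. Qed.

Lemma next_prime_prime m : 8 <= m -> prime (next_prime m).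
Proof.
move=> m_ge8; have [p p_pr /andP[le_mp le_p]] := prime_between m_ge8.
have found : has (fun k => prime (m + k)) (iota 0 (m ^ 2).*2.+1).
  apply/hasP; exists (p - m); last by rewrite subnKC.
  by rewrite mem_iota add0n ltnS (leq_trans (leq_subr _ _)).
have := nth_find 0 found; rewrite nth_iota ?add0n // -[X in _ < X](size_iota 0).
by rewrite -has_find.
Qed.

(** * Expansion of the parabola *)

Lemma sum_nat_Cauchy (I : finType) (B : {set I}) (F : I -> nat) :
  (\sum_(i in B) F i) ^ 2 <= #|B| * \sum_(i in B) F i ^ 2.
Proof.
rewrite -(leq_pmul2l (isT : 0 < 2)) -mulnn big_distrlr /= [leqRHS]mulnCA.
have -> : #|B| * (2 * \sum_(i in B) F i ^ 2) =
    \sum_(i in B) \sum_(j in B) (F i ^ 2 + F j ^ 2).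
  under [RHS]eq_bigr do rewrite big_split sum_nat_const.
  by rewrite big_split -big_distrr sum_nat_const /= -mulnDr addnn -mul2n.
rewrite big_distrr; apply: leq_sum => i _.
by rewrite big_distrr; apply: leq_sum => j _ /=; apply: nat_Cauchy.
Qed.

Section Expansion.

Variables (T U : finType) (R : T -> U -> bool).

Definition out_nbrs (x : T) : {set U} := [set y | R x y].

Definition nbrs_of_set (A : {set T}) : {set U} := [set y | [exists x in A, R x y]].

Definition in_degree (A : {set T}) (y : U) : nat := \sum_(x in A) R x y.

Lemma in_degree_eq0 A y : y \notin nbrs_of_set A -> in_degree A y = 0.
Proof.
rewrite inE => /exists_inPn noR; rewrite /in_degree big1 // => x xA.
by rewrite (negPf (noR x xA)).
Qed.

Lemma sum_in_degree A : \sum_y in_degree A y = \sum_(x in A) #|out_nbrs x|.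
Proof.
rewrite exchange_big; apply: eq_bigr => x _.
by rewrite -sum1dep_card [RHS]big_mkcond; apply: eq_bigr => y _; case: (R x y).
Qed.

Lemma sum_in_degree_sqr A : \sum_y in_degree A y ^ 2 =
  \sum_(x in A) \sum_(x' in A) #|out_nbrs x :&: out_nbrs x'|.
Proof.
under eq_bigr => y _ do rewrite -mulnn /in_degree big_distrlr /=.
rewrite exchange_big; apply: eq_bigr => x _; rewrite exchange_big.
apply: eq_bigr => x' _ /=; rewrite -sum1_card [RHS]big_mkcond.
by apply: eq_bigr => y _; rewrite mulnb !inE; case: (_ && _).
Qed.

Lemma sum_nbrs_of_set A (h : nat -> nat) : h 0 = 0 ->
  \sum_(y in nbrs_of_set A) h (in_degree A y) = \sum_y h (in_degree A y).
Proof.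
move=> h0; rewrite [RHS](bigID (mem (nbrs_of_set A))) /= [X in _ + X]big1 ?addn0 //.
by move=> y /in_degree_eq0->.
Qed.

Variables (q c : nat).
Hypothesis out_degree : forall x, #|out_nbrs x| = q.
Hypothesis codegree : forall x x', x != x' -> #|out_nbrs x :&: out_nbrs x'| <= c.

Lemma nbrs_of_set_expansion (A : {set T}) :
  q ^ 2 * #|A| <= #|nbrs_of_set A| * (q + c * #|A|).
Proof.
have [-> | A_neq0] := eqVneq A set0; first by rewrite cards0 muln0.
have sum_deg : \sum_(y in nbrs_of_set A) in_degree A y = #|A| * q.
  rewrite (sum_nbrs_of_set A (h := id)) // sum_in_degree -sum_nat_const.
  exact: eq_bigr.
have sum_deg2 : \sum_(y in nbrs_of_set A) in_degree A y ^ 2 <= #|A| * (q + c * #|A|).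
  rewrite (sum_nbrs_of_set A (h := expn^~ 2)) // sum_in_degree_sqr -sum_nat_const.
  apply: leq_sum => x xA; rewrite (bigD1 x) //= setIid out_degree leq_add2l.
  rewrite mulnC -sum_nat_const big_mkcondr /=; apply: leq_sum => x' _.
  by case: eqVneq => //= x'x; rewrite codegree // eq_sym.
rewrite -(@leq_pmul2l #|A|) ?card_gt0 // [leqRHS]mulnCA.
apply: leq_trans (leq_mul (leqnn _) sum_deg2).
apply: leq_trans (sum_nat_Cauchy _ _); rewrite sum_deg expnMn -mulnn.
by rewrite mulnCA mulnC mulnA.
Qed.

Lemma no_edge_expansion (A : {set T}) (B : {set U}) :
    {in A & B, forall x y, ~~ R x y} ->
  q ^ 2 * #|A| <= (#|U| - #|B|) * (q + c * #|A|).
Proof.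
move=> noR; apply: leq_trans (nbrs_of_set_expansion A) _.
rewrite leq_mul2r -(cardsC B) addKn; apply/orP; right.
apply/subset_leq_card/subsetP => y; rewrite !inE => /exists_inP[x xA Rxy].
by apply: contraL Rxy => yB; apply: noR.
Qed.

End Expansion.

Definition parabola (F : nzRingType) (c : F) (x y : F * F) : bool :=
  (x.1 != y.1) && (y.2 == x.2 + c * (y.1 - x.1) ^+ 2)%R.

Lemma parabola_converse (F : nzRingType) (c : F) x y :
  parabola c y x = parabola (- c)%R x y.
Proof.
rewrite /parabola [y.1 == _]eq_sym -(sqrrN (y.1 - x.1)%R) opprB mulNr -subr_eq.
by congr (_ && _); apply: eq_sym.
Qed.

Section Parabola.

Variables (F : finFieldType) (c : F).
Hypotheses (two_neq0 : (2%:R != 0 :> F)%R) (c_neq0 : (c != 0)%R).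

Lemma parabola_out_degree (x : F * F) : #|out_nbrs (parabola c) x| = #|F|.-1.
Proof.
pose g b := (b, x.2 + c * (b - x.1) ^+ 2)%R.
have g_inj : injective g by move=> b b' [].
rewrite -(cardsC1 x.1) -(card_imset _ g_inj); apply: eq_card => -[y1 y2].
rewrite !inE /parabola /= eq_sym.
apply/andP/imsetP => [[y1x1 /eqP->] | [b /[!inE] bx1 [-> ->]]] //.
by exists y1; rewrite ?inE.
Qed.

Lemma parabola_codegree (x x' : F * F) : x != x' ->
  #|out_nbrs (parabola c) x :&: out_nbrs (parabola c) x'| <= 1.
Proof.
case: x x' => [a b] [a' b'] neq; apply/card_le1_eqP => -[y1 y2] [z1 z2].
rewrite !inE /parabola /= => /andP[/andP[_ /eqP->] /andP[_ /eqP yE]].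
move=> /andP[/andP[_ /eqP->] /andP[_ /eqP zE]].
have : (2%:R * c * (a - a') * (y1 - z1) == 0)%R.
  apply/eqP; transitivity ((b + c * (z1 - a) ^+ 2 - (b' + c * (z1 - a') ^+ 2)) -
    (b + c * (y1 - a) ^+ 2 - (b' + c * (y1 - a') ^+ 2)))%R; first by ring.
  by rewrite yE zE !subrr.
rewrite !mulf_eq0 (negPf two_neq0) (negPf c_neq0) !subr_eq0.
case/orP=> [/eqP aE | /eqP-> //].
by move: yE neq; rewrite aE => /addIr->; rewrite eqxx.
Qed.

Lemma parabola_expansion (A B : {set F * F}) :
    {in A & B, forall x y, ~~ parabola c x y} ->
  #|F|.-1 ^ 2 * #|A| <= (#|F| ^ 2 - #|B|) * (#|F|.-1 + #|A|).
Proof.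
move/(no_edge_expansion parabola_out_degree parabola_codegree).
by rewrite card_prod mulnn mul1n.
Qed.

Lemma parabola_intransitive (x y z : F * F) :
  parabola c x y -> parabola c y z -> ~~ parabola c x z.
Proof.
case: x y z => [x1 x2] [y1 y2] [z1 z2] /andP[/= xy /eqP yE] /andP[/= yz /eqP zE].
rewrite negb_and; apply/orP; right; apply/eqP => zE'.
have : (2%:R * c * (x1 - y1) * (y1 - z1) == 0)%R.
  apply/eqP; transitivity (x2 + c * (z1 - x1) ^+ 2 -
    (x2 + c * (y1 - x1) ^+ 2 + c * (z1 - y1) ^+ 2))%R; first by ring.
  by rewrite -yE -zE -zE' subrr.
rewrite !mulf_eq0 (negPf two_neq0) (negPf c_neq0) !subr_eq0.
by rewrite (negPf xy) (negPf yz).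
Qed.

End Parabola.

(** * Independent sets and blow-ups *)

Lemma independentP (G : graph) (S : {set G}) :
  reflect {in S &, forall u v, ~~ adj u v} (independent S).
Proof.
apply: (iffP forall_inP) => [indS u v uS vS | indS u uS].
  exact: (forall_inP (indS u uS)).
by apply/forall_inP => v; apply: indS.
Qed.

Lemma independent_leq_IS (G : graph) (S : {set G}) : independent S -> #|S| <= IS G.
Proof. exact: leq_bigmax_cond. Qed.

Lemma IS_witness (G : graph) : exists2 S : {set G}, independent S & #|S| = IS G.
Proof.
have ind0 : 0 < #|[pred S : {set G} | independent S]|.
  by apply/card_gt0P; exists set0; apply/independentP => u v; rewrite inE.
by have [S indS maxS] := eq_bigmax_cond (fun S : {set G} => #|S|) ind0; exists S.
Qed.

Lemma independent_setU1 (G : graph) (S : {set G}) t :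
  independent S -> {in S, forall v, ~~ adj t v} -> independent (t |: S).
Proof.
move=> /independentP indS t_S.
apply/independentP => u v /setU1P[-> | uS] /setU1P[-> | vS].
- by rewrite adj_irr.
- exact: t_S.
- by rewrite adj_sym t_S.
- exact: indS.
Qed.

Lemma sum_nat_leq_average (T : finType) (A : {set T}) (w : T -> nat) M :
  {in A, forall u, #|T| * w u <= M} -> \sum_(u in A) w u <= M.
Proof.
have [T0 | T_gt0] := posnP #|T|; first by rewrite big1 // => u; have := card0_eq T0 u.
move=> w_le; rewrite -(leq_pmul2l T_gt0) big_distrr /=.
by apply: leq_trans (leq_sum _ w_le) _; rewrite sum_nat_const leq_mul2r max_card orbT.
Qed.

Section Charging.

Variables (G : graph) (w : G -> nat) (N : nat) (S : {set G}).
Hypothesis w_leN : forall u, w u <= N.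
Hypothesis indS : independent S.
Hypothesis outside_light : {in ~: S, forall u, #|G| * w u <= N}.
Hypothesis outside_charge : {in ~: S & S, forall u v, adj u v -> #|G| * w u <= N - w v}.

(* If every vertex outside [S] has a neighbour in [S], then the weight outside [S]
   is charged to the room left over [S]; otherwise [S] can be extended. *)
Lemma sum_weight_leq_IS : \sum_u w u <= IS G * N.
Proof.
rewrite (bigID (mem S)) /=.
have -> : \sum_(u | u \notin S) w u = \sum_(u in ~: S) w u.
  by apply: eq_bigl => u; rewrite inE.
have [dominating | ] := boolP [forall t in ~: S, [exists v in S, adj t v]].
  apply: leq_trans (leq_mul (independent_leq_IS indS) (leqnn N)).
  rewrite -sum_nat_const -(eq_bigr _ (fun u _ => subnKC (w_leN u))) big_split.
  rewrite leq_add2l; apply: sum_nat_leq_average => u uS.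
  have /exists_inP[v vS uv] := forall_inP dominating u uS.
  by rewrite (bigD1 v) //= (leq_trans (outside_charge uS vS uv)) ?leq_addr.
case/forall_inPn => t tS /exists_inPn t_isolated.
have := independent_leq_IS (independent_setU1 indS t_isolated).
rewrite cardsU1; rewrite inE in tS; rewrite tS add1n => lt_S_IS.
apply: leq_trans (leq_mul lt_S_IS (leqnn N)); rewrite mulSnr leq_add //.
  by rewrite -sum_nat_const leq_sum.
exact: sum_nat_leq_average.
Qed.

End Charging.

(* A set of [a] points with out-degree [q] and codegree 1 has at least
   q^2 a / (q + a) neighbours; for a light set this is at least n times its size. *)
Definition light (n q a : nat) : bool := n * (q + a) <= q ^ 2.

Lemma light_leq_room n q a b N : light n q a ->
  q ^ 2 * a <= (N - b) * (q + a) -> n * a <= N - b.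
Proof.
case: (posnP a) => [-> | a_gt0] light_a expansion; first by rewrite muln0.
rewrite -(@leq_pmul2r (q + a)) ?addn_gt0 ?a_gt0 ?orbT //.
by apply: leq_trans expansion; rewrite mulnAC leq_mul2r [_ <= _]light_a orbT.
Qed.

Lemma heavy_lt_room n q a b : n * n + 4 * n <= q -> b <= q.+1 ^ 2 ->
  ~~ light n q a -> ~~ light n q b -> (q.+1 ^ 2 - b) * (q + a) < q ^ 2 * a.
Proof.
rewrite /light -!ltnNge => q_large b_le heavy_a heavy_b.
have n_gt0 : 0 < n by move: heavy_a; case: n {q_large heavy_b}.
have q_gt0 : 0 < q by lia.
have room : n * (q.+1 ^ 2 - b) + q ^ 2 < n * (q ^ 2 + (3 * q + 1)).
  by rewrite mulnBr -!mulnn in heavy_b *; nia.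
have slack : n * (3 * q + 1) * (q + a) + n * q ^ 2 * q <= q ^ 2 * (q + a).
  apply: leq_trans (_ : (n * (3 * q + 1) + n * n * q) * (q + a) <= _).
    by rewrite mulnDl leq_add2l; nia.
  by rewrite leq_mul2r -mulnn; apply/orP; right; nia.
(* As [b] is heavy, n (N - b) < n (q^2 + 3 q + 1) - q^2; multiplied by q + a, this is
   at most n q^2 a, as [a] is heavy. *)
rewrite -(ltn_pmul2l n_gt0) mulnA.
have := room; rewrite -(@ltn_pmul2r (q + a)) ?addn_gt0 ?q_gt0 // !mulnDl !mulnDr.
by move: slack; rewrite !mulnDl !mulnDr !mulnA; lia.
Qed.

Section Blowup.

Variables (G : graph) (T : finType) (R : rel T).

Definition blowup_arc (a b : G * T) : bool :=
  (enum_rank a.1 < enum_rank b.1) && R a.2 b.2.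

Definition blowup_adj (a b : G * T) : bool :=
  adj a.1 b.1 && (blowup_arc a b || blowup_arc b a).

Lemma blowup_adj_sym : symmetric blowup_adj.
Proof. by move=> a b; rewrite /blowup_adj adj_sym orbC. Qed.

Lemma blowup_adj_irr : irreflexive blowup_adj.
Proof. by move=> a; rewrite /blowup_adj adj_irr. Qed.

Definition blowup : graph := Graph blowup_adj_sym blowup_adj_irr.

Lemma blowup_triangle_free :
  (forall x y z, R x y -> R y z -> ~~ R x z) -> triangle_free blowup.
Proof.
move=> intransR [[|a [|b [|c [|? ?]]]] [/andP[/= triangle _] //]] _.
have noT x y z : blowup_arc x y -> blowup_arc y z -> blowup_arc x z -> False.
  by move=> /andP[_ Rxy] /andP[_ Ryz] /andP[_]; apply/negP/(intransR _ y.2).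
have noC x y z : blowup_arc x y -> blowup_arc y z -> blowup_arc z x -> False.
  move=> /andP[xy _] /andP[yz _] /andP[zx _].
  by have := ltn_trans xy (ltn_trans yz zx); rewrite ltnn.
case/and4P: triangle => /andP[_ /orP[] ab] /andP[_ /orP[] bc] /andP[_ /orP[] ca] _.
all: by [ exact: noC ab bc ca | exact: noC ab ca bc
   | exact: noT ab bc ca | exact: noT ca ab bc | exact: noT ca bc ab
   | exact: noT bc ca ab | exact: noT ab ca bc | exact: noT bc ab ca ].
Qed.

Lemma IS_blowup_geq : IS G * #|T| <= IS blowup.
Proof.
have [S /independentP indS <-] := IS_witness G; rewrite -cardsT -cardsX.
apply: (@independent_leq_IS blowup); apply/independentP => -[u x] [v y].
rewrite !in_setX => /andP[uS _] /andP[vS _].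
by rewrite /= /blowup_adj (negPf (indS _ _ uS vS)).
Qed.

Definition fiber (S : {set blowup}) (u : G) : {set T} := [set x | (u, x) \in S].

Lemma sum_card_fiber (S : {set blowup}) : #|S| = \sum_u #|fiber S u|.
Proof.
transitivity (\sum_(a : G * T | a \in S) 1); first by rewrite sum1_card.
rewrite (eq_bigl (fun a : G * T => (a.1, a.2) \in S)); last by case.
rewrite -(pair_big_dep xpredT (fun u x => (u, x) \in S) (fun _ _ => 1)) /=.
by apply: eq_bigr => u _; rewrite -sum1dep_card.
Qed.

Lemma fiber_no_arc (S : {set blowup}) (u v : G) : independent S -> adj u v ->
  {in fiber S u & fiber S v, forall x y,
    ~~ blowup_arc (u, x) (v, y) && ~~ blowup_arc (v, y) (u, x)}.
Proof.
move=> /independentP indS uv x y /[!inE] xS yS.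
by have := indS _ _ xS yS; rewrite /= /blowup_adj uv negb_or.
Qed.

End Blowup.

Arguments blowup : clear implicits.

Section ParabolaBlowup.

Variables (G : graph) (F : finFieldType) (c : F).
Hypotheses (two_neq0 : (2%:R != 0 :> F)%R) (c_neq0 : (c != 0)%R).

Local Notation lift := (blowup G (F * F)%type (parabola c)).

Lemma fiber_expansion (S : {set lift}) (u v : G) : independent S -> adj u v ->
  #|F|.-1 ^ 2 * #|fiber S u| <= (#|F| ^ 2 - #|fiber S v|) * (#|F|.-1 + #|fiber S u|).
Proof.
move=> indS uv; have no_arc := fiber_no_arc indS uv.
case: (ltngtP (enum_rank u) (enum_rank v)) => [lt_uv | lt_vu | eq_uv].
- apply: (parabola_expansion two_neq0 c_neq0) => x y xu yv.
  by have /andP[+ _] := no_arc x y xu yv; rewrite /blowup_arc lt_uv.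
- have oppc_neq0 : (- c != 0)%R by rewrite oppr_eq0.
  apply: (parabola_expansion two_neq0 oppc_neq0) => x y xu yv.
  have /andP[_] := no_arc x y xu yv.
  by rewrite /blowup_arc lt_vu /= parabola_converse.
- by move: uv; rewrite (enum_rank_inj (val_inj eq_uv)) adj_irr.
Qed.

Lemma IS_parabola_blowup : #|G| * #|G| + 4 * #|G| < #|F| -> IS lift = IS G * #|F| ^ 2.
Proof.
move=> F_large; set q := #|F|.-1; apply/eqP; rewrite eqn_leq.
rewrite -{2}mulnn -card_prod IS_blowup_geq andbT.
have F_size : #|F| = q.+1 by rewrite /q prednK // (leq_ltn_trans _ F_large).
apply/bigmax_leqP => S indS; rewrite sum_card_fiber.
pose w u := #|fiber S u|; pose heavy := [set u | ~~ light #|G| q (w u)].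
have w_leN u : w u <= #|F| ^ 2 by rewrite -mulnn -card_prod max_card.
apply: (@sum_weight_leq_IS _ _ _ heavy) => //.
- apply/independentP => u v /[!inE] heavy_u heavy_v.
  apply/negP => /(fiber_expansion indS); apply/negP; rewrite -ltnNge -/q F_size.
  by apply: heavy_lt_room heavy_u heavy_v; [lia | rewrite -F_size w_leN].
- move=> u /[!inE]; rewrite negbK F_size /light => light_u.
  apply: leq_trans (_ : q ^ 2 <= _); last by rewrite leq_exp2r.
  by apply: leq_trans light_u; rewrite leq_mul2l leq_addl orbT.
move=> u v /[!inE]; rewrite negbK => light_u _ /(fiber_expansion indS).
exact: light_leq_room.
Qed.

End ParabolaBlowup.

(** * The lifted graph *)

(* n^2 + 4 n is the bound of [heavy_lt_room], and [prime_between] starts at 8. *)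
Definition side_bound (n : nat) : nat := n * n + 4 * n + 8.

Definition side (n : nat) : nat := next_prime (side_bound n).

Lemma leq_side n : side_bound n <= side n.
Proof. exact: leq_next_prime. Qed.

Lemma side_prime n : prime (side n).
Proof. by apply: next_prime_prime; apply: leq_addl. Qed.

Lemma side_gt2 n : 2 < side n.
Proof. by apply: leq_trans (leq_side n); rewrite /side_bound; lia. Qed.

Lemma two_Fp_neq0 p : prime p -> 2 < p -> (2%:R != 0 :> 'F_p)%R.
Proof. by move=> p_pr p_gt2; rewrite -unitfE unitFpE // prime_coprime // gtnNdvd. Qed.

Definition lift_graph (G : graph) : graph :=
  let F := 'F_(side #|G|) in blowup G (F * F)%type (parabola (1 : F)%R).

Lemma lift_graph_triangle_free (G : graph) : triangle_free (lift_graph G).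
Proof.
apply: blowup_triangle_free => x y z; apply: parabola_intransitive (oner_neq0 _) _ _ _.
exact: two_Fp_neq0 (side_prime _) (side_gt2 _).
Qed.

Lemma card_lift_graph (G : graph) : #|lift_graph G| = #|G| * side #|G| ^ 2.
Proof. by rewrite !card_prod card_Fp ?side_prime. Qed.

Lemma IS_lift_graph (G : graph) : IS (lift_graph G) = IS G * side #|G| ^ 2.
Proof.
have card_F : #|'F_(side #|G|) : finFieldType| = side #|G|.
  exact: card_Fp (side_prime _).
have two_neq0 := two_Fp_neq0 (side_prime #|G|) (side_gt2 #|G|).
rewrite -[in RHS]card_F; apply: IS_parabola_blowup two_neq0 (oner_neq0 _) _.
by rewrite card_F; have := leq_side #|G|; rewrite /side_bound; lia.
Qed.

Lemma rel_IS_lift_graph (G : graph) : rel_IS (lift_graph G) = rel_IS G.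
Proof.
have side2_neq0 : ((side #|G| ^ 2)%:R != 0 :> rat)%R.
  by rewrite Num.Theory.pnatr_eq0 expn_eq0 negb_and -lt0n prime_gt0 ?side_prime.
rewrite /rel_IS IS_lift_graph card_lift_graph (natrM _ (IS G)) (natrM _ #|G|).
by rewrite -mulf_div divff // mulr1.
Qed.

(** * Structured code for the random access machine *)

Definition reaches (P : program) (t : nat) (c : config) (Q : config -> Prop) : Prop :=
  exists2 k, k <= t & Q (iter k (step P) c).

Lemma reaches_refl P t c (Q : config -> Prop) : Q c -> reaches P t c Q.
Proof. by exists 0. Qed.

Lemma reaches_step P t c Q : reaches P t (step P c) Q -> reaches P t.+1 c Q.
Proof. by case=> k le_kt Qc; exists k.+1; rewrite // iterSr. Qed.

Lemma reaches_bind P t1 t2 c (Q1 Q2 : config -> Prop) :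
    reaches P t1 c Q1 -> (forall c', Q1 c' -> reaches P t2 c' Q2) ->
  reaches P (t1 + t2) c Q2.
Proof.
move=> [k1 le1 Qc1] /(_ _ Qc1)[k2 le2 Qc2].
by exists (k2 + k1); rewrite ?iterD // addnC leq_add.
Qed.

Lemma iter_step_halted P c t : size P <= pc c -> iter t (step P) c = c.
Proof. by move=> halted; elim: t => //= t ->; rewrite /step onth_default. Qed.

Lemma reaches_halted P t c (Q : config -> Prop) :
  reaches P t c (fun c' => size P <= pc c' /\ Q c') ->
  size P <= pc (iter t (step P) c) /\ Q (iter t (step P) c).
Proof.
case=> k le_kt [halted Qc]; rewrite -(subnK le_kt) iterD.
by rewrite iter_step_halted.
Qed.

(* Jumps are absolute, so that code depends on the address at which it is loaded. *)
Definition code := nat -> seq instr.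

Definition goto (k : nat) (s : config) : config := Config k (reg s) (inp s) (out s).

Definition loads (P : program) (o : nat) (l : seq instr) : Prop :=
  exists pre suf, P = pre ++ l ++ suf /\ size pre = o.

Lemma loads_cat P o l1 l2 :
  loads P o (l1 ++ l2) -> loads P o l1 /\ loads P (o + size l1) l2.
Proof.
case=> pre [suf [-> <-]]; split; first by exists pre, (l2 ++ suf); rewrite -catA.
by exists (pre ++ l1), suf; rewrite -!catA size_cat.
Qed.

Lemma loads_cons P o a l :
  loads P o (a :: l) -> onth P o = Some a /\ loads P o.+1 l.
Proof.
rewrite -cat1s => /loads_cat[[pre [suf [-> <-]]]]; rewrite addn1.
by rewrite onth_cat ltnn subnn.
Qed.

Lemma step_goto P o a s : onth P o = Some a -> step P (goto o s) = exec a (goto o s).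
Proof. by rewrite /step /= => ->. Qed.

Definition runs (c : code) (t : nat) (s : config) (Q : config -> Prop) : Prop :=
  forall P o, loads P o (c o) ->
  reaches P t (goto o s) (fun s' => exists2 s1, s' = goto (o + size (c o)) s1 & Q s1).

Lemma runs_weaken c t t' s (Q Q' : config -> Prop) :
  runs c t s Q -> t <= t' -> (forall s', Q s' -> Q' s') -> runs c t' s Q'.
Proof.
move=> run le_t sQ P o /run[k le_k [s' Ek Qs']].
by exists k; [apply: leq_trans le_t | exists s'; [| apply: sQ]].
Qed.

Lemma runs_halts (c : code) x y t :
  runs c t (init_config x) (fun s => out s = y) -> halts_within (c 0) x t y.
Proof.
have ld : loads (c 0) 0 (c 0) by exists [::], [::]; rewrite cats0.
move=> /(_ _ _ ld) run; apply: (@reaches_halted _ _ _ (fun s => out s = y)).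
rewrite -(addn0 t); apply: reaches_bind run _ => _ [s -> outs].
by apply: reaches_refl; rewrite /= add0n.
Qed.

Definition straight (a : instr) : bool := if a is IJumpPos _ _ then false else true.

Definition block (l : seq instr) : code := fun=> l.

Definition exec_seq (s : config) (l : seq instr) : config :=
  foldl (fun s a => exec a s) s l.

Lemma exec_goto a o s : straight a -> exec a (goto o s) = goto o.+1 (exec a s).
Proof. by case: a. Qed.

Lemma runs_block l s (Q : config -> Prop) :
  all straight l -> Q (exec_seq s l) -> runs (block l) (size l) s Q.
Proof.
move=> + + P o; rewrite /block; elim: l s o => [|a l IHl] s o /=.
  by move=> _ Qs _; apply: reaches_refl; exists s; rewrite ?addn0.
case/andP=> str_a str_l Qs /loads_cons[at_o ld]; apply: reaches_step.
by rewrite (step_goto _ at_o) exec_goto // -addSnnS; apply: IHl.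
Qed.

Definition seqc (c1 c2 : code) : code := fun o => c1 o ++ c2 (o + size (c1 o)).
Notation "c1 ;; c2" := (seqc c1 c2) (at level 85, right associativity).

Lemma runs_seq c1 c2 t1 t2 s (Q : config -> Prop) :
  runs c1 t1 s (fun s' => runs c2 t2 s' Q) -> runs (c1 ;; c2) (t1 + t2) s Q.
Proof.
move=> run P o /loads_cat[ld1 ld2]; rewrite size_cat addnA.
by apply: reaches_bind (run _ _ ld1) _ => _ [s1 -> ]; apply.
Qed.

(* [test] leaves the condition in register 0. *)
Definition while_loop (test body : code) : code := fun o =>
  let entry := o.+2 + size (body o.+2) in
  [:: IConst 0 1; IJumpPos entry 0] ++ body o.+2 ++ test entry ++ [:: IJumpPos o.+2 0].

Lemma runs_while (I : nat -> config -> Prop) test body t1 t2 m s :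
    I m (exec (IConst 0 1) s) ->
    (forall k s1, I k s1 ->
       runs test t1 s1 (fun s2 => I k s2 /\ (0 < reg s2 0) = (0 < k))) ->
    (forall k s1, I k.+1 s1 -> runs body t2 s1 (I k)) ->
  runs (while_loop test body) (m * (t1 + 1 + t2) + (t1 + 1) + 2) s (I 0).
Proof.
move=> Im run_test run_body P o; rewrite /while_loop.
set first := o.+2; set entry := first + _; set exit := o + _.
have exitE : exit = (entry + size (test entry)).+1.
  by rewrite /exit /entry /first !size_cat /=; lia.
case/loads_cons=> at0 /loads_cons[at1 /loads_cat[ld_body /loads_cat[ld_test]]].
case/loads_cons=> at_jump _.
have test_step t k s1 Q : I k s1 ->
    (forall s2, I k s2 -> reaches P t (goto (if 0 < k then first else exit) s2) Q) ->
    reaches P (t1 + 1 + t) (goto entry s1) Q.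
  move=> Ik reachQ; rewrite -addnA.
  apply: reaches_bind (run_test _ _ Ik _ _ ld_test) _ => _ [s2 -> [Ik2 pos]].
  by apply: reaches_step; rewrite (step_goto _ at_jump) /= pos -exitE; apply: reachQ.
rewrite addn2; do 2!apply: reaches_step; rewrite (step_goto _ at0).
rewrite (step_goto (exec (IConst 0 1) s) at1) /=.
rewrite -[Config _ _ _ _]/(goto entry (exec (IConst 0 1) s)).
elim: m (exec _ s) Im => [|m IHm] s1 Im.
  rewrite mul0n add0n -(addn0 (t1 + 1)); apply: test_step Im _ => s2 I2.
  by apply: reaches_refl; exists s2.
rewrite mulSn -addnA -(addnA (t1 + 1)); apply: test_step Im _ => s2 Im2.
by apply: reaches_bind (run_body _ _ Im2 _ _ ld_body) _ => _ [s3 -> /IHm].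
Qed.

(** * Registers *)

(* Register 0 holds jump conditions, the positive even registers hold variables
   and temporaries, and the odd ones form an array. *)
Definition slot (x : nat) : nat := x.+1.*2.

Definition cell (k : nat) : nat := k.*2.+1.

Definition kept (d r : nat) : bool := odd r || (0 < r < slot d).

Lemma slot_eq x y : (slot x == slot y) = (x == y).
Proof. by rewrite /slot; lia. Qed.

Lemma cell_eq j k : (cell j == cell k) = (j == k).
Proof. by rewrite /cell; lia. Qed.

Lemma slot_eq0 x : (slot x == 0) = false.
Proof. by []. Qed.

Lemma cell_eq0 k : (cell k == 0) = false.
Proof. by []. Qed.

Lemma cell_eq_slot k x : (cell k == slot x) = false.
Proof. by rewrite /cell /slot; lia. Qed.

Lemma slot_eq_cell k x : (slot x == cell k) = false.
Proof. by rewrite eq_sym cell_eq_slot. Qed.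

Definition regE := (slot_eq, cell_eq, slot_eq0, cell_eq0, cell_eq_slot, slot_eq_cell).

Lemma kept_slot d x : kept d (slot x) = (x < d).
Proof. by rewrite /kept /slot odd_double ltn_double ltnS. Qed.

Lemma kept_cell d k : kept d (cell k).
Proof. by rewrite /kept /cell /= odd_double. Qed.

Lemma kept_leq d d' r : d <= d' -> kept d r -> kept d' r.
Proof.
by rewrite /kept /slot => le_d; case: odd => //= /andP[-> /leq_trans->] //; lia.
Qed.

Arguments slot : simpl never.
Arguments cell : simpl never.
Arguments kept : simpl never.

Definition emits (d : nat) (y : seq nat) (s s' : config) : Prop :=
  [/\ forall r, kept d r -> reg s' r = reg s r, inp s' = inp s & out s' = out s ++ y].

Lemma emits_refl d s : emits d [::] s s.
Proof. by split; rewrite ?cats0. Qed.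

Lemma emits_trans d y1 y2 s1 s2 s3 :
  emits d y1 s1 s2 -> emits d y2 s2 s3 -> emits d (y1 ++ y2) s1 s3.
Proof.
move=> [r12 i12 o12] [r23 i23 o23]; split; rewrite ?i23 ?o23 ?o12 ?catA // => r rd.
by rewrite r23 ?r12.
Qed.

Lemma emits_leq d d' y s s' : d <= d' -> emits d' y s s' -> emits d y s s'.
Proof. by move=> le_d [rE iE oE]; split=> // r /(kept_leq le_d)/rE. Qed.

Lemma emits_reg d y s s' r : emits d y s s' -> kept d r -> reg s' r = reg s r.
Proof. by case=> rE _ _ /rE. Qed.

Definition writes_scratch (d : nat) (a : instr) : bool :=
  match a with
  | IConst i _ | IAdd i _ _ | ISub i _ _ | ILoad i _ => ~~ kept d i
  | _ => false
  end.

Lemma emits_exec_seq d l s : all (writes_scratch d) l -> emits d [::] s (exec_seq s l).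
Proof.
have set_regE s1 i x : ~~ kept d i -> emits d [::] s1 (set_reg s1 i x).
  move=> i_free; split; rewrite ?cats0 //= => r rd.
  by case: eqP rd i_free => // -> ->.
elim: l s => [|a l IHl] s /=; first by move=> _; apply: emits_refl.
case/andP=> a_free /IHl l_emits; apply: (@emits_trans _ [::] [::]) (l_emits _).
by case: a a_free => //= *; apply: set_regE.
Qed.

Lemma runs_scratch d l s (Q : config -> Prop) : all (writes_scratch d) l ->
    (forall s', emits d [::] s s' -> reg s' =1 reg (exec_seq s l) -> Q s') ->
  runs (block l) (size l) s Q.
Proof.
move=> l_free sQ; apply: runs_block; last by apply: sQ => //; apply: emits_exec_seq.
by apply: sub_all l_free => -[].
Qed.

Definition for_loop (i b : nat) (body : code) : code :=
  block [:: IConst (slot i) 0] ;;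
  while_loop (block [:: ISub 0 (slot b) (slot i)])
    (body ;; block [:: IConst 0 1; IAdd (slot i) (slot i) 0]).

Lemma runs_for (I : nat -> config -> Prop) i b c t N s :
    b < i -> reg s (slot b) = N ->
    (forall k s1 s2, emits i [::] s1 s2 -> I k s1 -> I k s2) -> I 0 s ->
    (forall k s1, k < N -> reg s1 (slot i) = k -> reg s1 (slot b) = N -> I k s1 ->
       runs c t s1 (fun s2 =>
         [/\ reg s2 (slot i) = k, reg s2 (slot b) = N & I k.+1 s2])) ->
  runs (for_loop i b c) (N * (t + 4) + 5) s (I N).
Proof.
move=> lt_bi bN I_emits I0 run_c; have i_neq_b : (b == i) = false by lia.
pose J m s1 := exists k,
  [/\ k + m = N, reg s1 (slot i) = k, reg s1 (slot b) = N & I k s1].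
have J_emits m s1 s2 : emits i [::] s1 s2 -> reg s2 (slot i) = reg s1 (slot i) ->
    J m s1 -> J m s2.
  move=> E iE [k [kN ik bk Ik]].
  by exists k; rewrite iE (emits_reg E) ?kept_slot //; split=> //; apply: I_emits Ik.
have -> : N * (t + 4) + 5 = 1 + (N * (1 + 1 + (t + 2)) + (1 + 1) + 2) by lia.
apply/runs_seq/(runs_scratch (d := i)) => [|s1 E1 s1E].
  by rewrite /= kept_slot ltnn.
apply: (runs_weaken (Q := J 0) _ (leqnn _)) => [|s' [k [kN _ _ Ik]]]; last first.
  by rewrite -kN addn0.
apply: runs_while => [|m s2 J2|m s2 [k [kN ik bk Ik]]].
- apply: J_emits (emits_exec_seq (d := i) s1 (l := [:: IConst 0 1]) _) _ _ => //.
  exists 0; rewrite !s1E /= !regE eqxx i_neq_b add0n.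
  by split=> //; apply: I_emits E1 I0.
- apply: (runs_scratch (d := i) (l := [:: _])) => // s3 E3 s3E.
  split; first by apply: J_emits E3 _ J2; rewrite s3E.
  by case: J2 => k [kN ik bk _]; rewrite s3E /= ik bk -kN addKn.
apply: runs_seq; have lt_kN : k < N by lia.
apply: runs_weaken (run_c k s2 lt_kN ik bk Ik) (leqnn _) _ => s3 [ik3 bk3 Ik3].
apply: (runs_scratch (d := i) (l := [:: _; _])) => [|s4 E4 s4E].
  by rewrite /= kept_slot ltnn.
exists k.+1; rewrite (emits_reg (r := slot b) E4) ?kept_slot // bk3 addSnnS; split=> //.
  by rewrite s4E /= !regE eqxx ik3 addn1.
exact: I_emits Ik3.
Qed.

Lemma runs_for_emits i b c t N s (g : nat -> seq nat) :
    b < i -> reg s (slot b) = N ->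
    (forall k s1 y, k < N -> reg s1 (slot i) = k -> emits i y s s1 ->
       runs c t s1 (emits i.+1 (g k) s1)) ->
  runs (for_loop i b c) (N * (t + 4) + 5) s
    (emits i (flatten [seq g k | k <- iota 0 N]) s).
Proof.
move=> lt_bi bN run_c.
pose I k s1 := emits i (flatten [seq g j | j <- iota 0 k]) s s1.
apply: (runs_for (I := I)) => // [k s1 s2 E1 I1||k s1 lt_kN ik bk Ik].
- by rewrite /I -[flatten _]cats0; apply: emits_trans I1 E1.
- exact: emits_refl.
apply: runs_weaken (run_c k s1 _ lt_kN ik Ik) (leqnn _) _ => s2 E.
rewrite !(emits_reg E) ?kept_slot ?(leqW lt_bi) //; split=> //.
rewrite /I -addn1 iotaD map_cat flatten_cat /= cats0; apply: emits_trans Ik _.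
exact: emits_leq E.
Qed.

(** * Arithmetic expressions with bounded sums *)

(* Variables are de Bruijn indices: [ESum a b] is the sum of [b] for a new
   variable 0 ranging over the numbers below [a], and [ELoad] reads an array. *)
Inductive expr :=
  | EConst of nat
  | EVar of nat
  | ELoad of expr
  | EAdd of expr & expr
  | ESub of expr & expr
  | ESum of expr & expr.

Fixpoint eval (m : nat -> nat) (env : seq nat) (e : expr) : nat :=
  match e with
  | EConst c => c
  | EVar i => nth 0 env i
  | ELoad a => m (eval m env a)
  | EAdd a b => eval m env a + eval m env b
  | ESub a b => eval m env a - eval m env b
  | ESum a b => \sum_(k < eval m env a) eval m (val k :: env) b
  end.

Fixpoint value_bound (e : expr) (B : nat) : nat :=
  match e with
  | EConst c => c
  | EVar _ | ELoad _ => B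
  | EAdd a b => value_bound a B + value_bound b B
  | ESub a _ => value_bound a B
  | ESum a b => value_bound a B * value_bound b (B + value_bound a B)
  end.

Definition bounded (B : nat) (m : nat -> nat) (env : seq nat) : Prop :=
  (forall k, m k <= B) /\ all (leq^~ B) env.

Lemma bounded_cons B B' k m env :
  bounded B m env -> k <= B' -> bounded (B + B') m (k :: env).
Proof.
move=> [m_le /allP env_le] le_k; split=> [j|]; first exact: leq_trans (leq_addr _ _).
rewrite /= (leq_trans le_k) ?leq_addl //; apply/allP => x /env_le /leq_trans.
by apply; apply: leq_addr.
Qed.

Lemma leq_value_bound e B m env : bounded B m env -> eval m env e <= value_bound e B.
Proof.
elim: e B env => [c|i|a _|a IHa b IHb|a IHa b _|a IHa b IHb] B env env_le /=.
- by [].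
- case: env_le => _ /allP env_le.
  by case: (ltnP i (size env)) => [/(mem_nth 0)/env_le | /(nth_default 0)->].
- by case: env_le.
- by apply: leq_add; [apply: IHa | apply: IHb].
- exact: leq_trans (leq_subr _ _) (IHa _ _ env_le).
have a_le := IHa _ _ env_le.
apply: leq_trans (leq_mul a_le (leqnn _)).
rewrite -[in leqRHS](card_ord (eval m env a)) -sum_nat_const.
apply: leq_sum => k _; apply: IHb; apply: bounded_cons env_le _.
exact: leq_trans (ltnW (ltn_ord k)) a_le.
Qed.

Fixpoint cost_bound (e : expr) (B : nat) : nat :=
  match e with
  | EConst _ => 1
  | EVar _ => 2
  | ELoad a => cost_bound a B + 4
  | EAdd a b | ESub a b => cost_bound a B + (cost_bound b B + 1)
  | ESum a b => let N := value_bound a B in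
      cost_bound a B + (1 + (N * (cost_bound b (B + N) + 1 + 4) + 5))
  end.

Definition cell_address (d x : nat) : seq instr :=
  [:: IAdd (slot d) (slot x) (slot x); IConst 0 1; IAdd (slot d) (slot d) 0].

(* The value of [e] goes to slot [d]; smaller slots are not touched, and [l] lists
   the registers of the variables. *)
Fixpoint compile (l : seq nat) (d : nat) (e : expr) : code :=
  match e with
  | EConst c => block [:: IConst (slot d) c]
  (* For an index out of range, [nth] falls back on slot [d], which is 0 by then. *)
  | EVar i => block [:: IConst (slot d) 0; IAdd (slot d) (nth (slot d) l i) (slot d)]
  | ELoad a => compile l d a ;;
      block (rcons (cell_address d d) (ILoad (slot d) (slot d)))
  | EAdd a b => compile l d a ;; compile l d.+1 b ;;
      block [:: IAdd (slot d) (slot d) (slot d.+1)]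
  | ESub a b => compile l d a ;; compile l d.+1 b ;;
      block [:: ISub (slot d) (slot d) (slot d.+1)]
  | ESum a b => compile l d.+1 a ;; block [:: IConst (slot d) 0] ;;
      for_loop d.+2 d.+1
        (compile (slot d.+2 :: l) d.+3 b ;;
         block [:: IAdd (slot d) (slot d) (slot d.+3)])
  end.

Definition represents (d : nat) (l : seq nat) (m : nat -> nat) (env : seq nat)
    (s : config) : Prop :=
  [/\ all (kept d) l, forall k, reg s (cell k) = m k & [seq reg s r | r <- l] = env].

Lemma represents_emits d y l m env s s' :
  emits d y s s' -> represents d l m env s -> represents d l m env s'.
Proof.
move=> E [l_kept mE envE]; split=> // [k|]; first by rewrite (emits_reg E) ?kept_cell.
by rewrite -envE; apply/eq_in_map => r /(allP l_kept)/(emits_reg E).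
Qed.

Lemma represents_leq d d' l m env s :
  d <= d' -> represents d l m env s -> represents d' l m env s.
Proof.
move=> le_d [l_kept mE envE]; split=> //.
by apply: sub_all l_kept => r; apply: kept_leq.
Qed.

Lemma represents_cons d x k l m env s : x < d -> reg s (slot x) = k ->
  represents d l m env s -> represents d (slot x :: l) m (k :: env) s.
Proof.
move=> x_lt xE [l_kept mE envE].
by split=> //=; rewrite ?kept_slot ?x_lt // xE envE.
Qed.

Definition compiles (e : expr) : Prop := forall d l m env s B (Q : config -> Prop),
    represents d l m env s -> bounded B m env ->
    (forall s', emits d [::] s s' -> reg s' (slot d) = eval m env e -> Q s') ->
  runs (compile l d e) (cost_bound e B) s Q.

Lemma compiles_const c : compiles (EConst c).
Proof.
move=> d l m env s B Q _ _ sQ.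
apply: (runs_scratch (d := d) (l := [:: _])) => [|s' E s'E].
  by rewrite /= kept_slot ltnn.
by apply: sQ; rewrite // s'E /= eqxx.
Qed.

Lemma compiles_var i : compiles (EVar i).
Proof.
move=> d l m env s B Q [l_kept _ envE] _ sQ.
apply: (runs_scratch (d := d) (l := [:: _; _])) => [|s' E s'E].
  by rewrite /= kept_slot ltnn.
apply: sQ; rewrite // s'E /= !eqxx addn0 -envE.
have [i_lt | i_ge] := ltnP i (size l); last first.
  by rewrite !nth_default ?size_map // eqxx.
rewrite (nth_map (slot d)) //; case: eqP => // i_d.
by have := allP l_kept _ (mem_nth (slot d) i_lt); rewrite i_d kept_slot ltnn.
Qed.

Lemma compiles_load a : compiles a -> compiles (ELoad a).
Proof.
move=> IHa d l m env s B Q repr env_le sQ.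
apply/runs_seq/(IHa _ _ _ _ _ _ _ repr) => // s1 E1 aE.
apply: (runs_scratch (d := d) (l := [:: _; _; _; _])) => [|s2 E2 s2E].
  by rewrite /= kept_slot ltnn.
apply: sQ; first exact: emits_trans E1 E2.
have [_ mE _] := represents_emits E1 repr.
by rewrite s2E /= !regE !eqxx /= aE addn1 addnn -/(cell _) !regE mE.
Qed.

Lemma runs_compile_binop (op : nat -> nat -> nat)
    (op_instr : nat -> nat -> nat -> instr) a b d l m env s B (Q : config -> Prop) :
    (forall i j k, ~~ kept d i -> writes_scratch d (op_instr i j k)) ->
    (forall i j k s',
       exec (op_instr i j k) s' = set_reg s' i (op (reg s' j) (reg s' k))) ->
    compiles a -> compiles b -> represents d l m env s -> bounded B m env ->
    (forall s', emits d [::] s s' ->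
       reg s' (slot d) = op (eval m env a) (eval m env b) -> Q s') ->
  runs (compile l d a ;; compile l d.+1 b ;;
        block [:: op_instr (slot d) (slot d) (slot d.+1)])
    (cost_bound a B + (cost_bound b B + 1)) s Q.
Proof.
move=> op_scratch opE IHa IHb repr env_le sQ.
apply/runs_seq/(IHa _ _ _ _ _ _ _ repr) => // s1 E1 aE.
have repr1 := represents_leq (leqnSn d) (represents_emits E1 repr).
apply/runs_seq/(IHb _ _ _ _ _ _ _ repr1) => // s2 E2 bE.
apply: (runs_scratch (d := d) (l := [:: _])) => [|s3 E3 s3E].
  by rewrite /= op_scratch ?kept_slot ?ltnn.
apply: sQ; last by rewrite s3E /= opE /= eqxx bE (emits_reg E2) ?kept_slot ?aE.
apply: emits_trans E1 _; exact: emits_trans (emits_leq (leqnSn d) E2) E3.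
Qed.

Lemma compiles_add a b : compiles a -> compiles b -> compiles (EAdd a b).
Proof.
move=> IHa IHb d l m env s B Q repr env_le.
exact: (runs_compile_binop (op := addn) (op_instr := IAdd)).
Qed.

Lemma compiles_sub a b : compiles a -> compiles b -> compiles (ESub a b).
Proof.
move=> IHa IHb d l m env s B Q repr env_le.
exact: (runs_compile_binop (op := subn) (op_instr := ISub)).
Qed.

Lemma compiles_sum a b : compiles a -> compiles b -> compiles (ESum a b).
Proof.
move=> IHa IHb d l m env s B Q repr env_le sQ; set N := eval m env a.
have le_N : N <= value_bound a B by apply: leq_value_bound.
apply/runs_seq/(IHa _ _ _ _ _ _ _ (represents_leq (leqnSn d) repr)) => // s1 E1 aE.
apply/runs_seq/(runs_scratch (d := d) (l := [:: _])) => [|s2 E2 s2E].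
  by rewrite /= kept_slot ltnn.
have {}E2 : emits d [::] s s2 by apply: emits_trans (emits_leq (leqnSn d) E1) E2.
pose I k s' := emits d [::] s s' /\
  reg s' (slot d) = \sum_(j < k) eval m (val j :: env) b.
pose t := cost_bound b (B + value_bound a B) + 1.
apply: (@runs_weaken _ (N * (t + 4) + 5) _ _ (I N)) => [||s' [E sumE]]; last first.
- exact: sQ.
- by rewrite leq_add2r leq_mul2r le_N orbT.
apply: runs_for => // [|k s3 s4 E [E3 sumE]||k s3 lt_k kE NE [E3 sumE]].
- by rewrite s2E /= regE (gtn_eqF (ltnSn d)).
- split; last by rewrite (emits_reg E) ?kept_slot ?ltnS.
  by apply: emits_trans E3 (emits_leq _ E); apply: leqW.
- by split; rewrite // s2E /= eqxx big_ord0.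
have repr3 := represents_leq (leqW (leqW (leqnSn d))) (represents_emits E3 repr).
have env_le3 := bounded_cons env_le (leq_trans (ltnW lt_k) le_N).
apply/runs_seq/(IHb _ _ _ _ _ _ _ (represents_cons (leqnn _) kE repr3)) => // s4 E4 bE.
apply: (runs_scratch (d := d) (l := [:: _])) => [|s5 E5 s5E].
  by rewrite /= kept_slot ltnn.
have keep_above x : d < x < d.+3 -> reg s5 (slot x) = reg s3 (slot x).
  move=> /andP[lt_dx lt_x]; rewrite s5E /= regE (gtn_eqF lt_dx).
  by rewrite (emits_reg E4) ?kept_slot.
rewrite !keep_above ?leqnn ?ltnS ?leqnSn //; split=> //.
split.
  apply: (@emits_trans _ [::] [::] _ _ _ E3).
  by apply: emits_trans (emits_leq _ E4) E5; rewrite -addn3 leq_addr.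
by rewrite s5E /= eqxx bE (emits_reg E4) ?kept_slot ?big_ord_recr ?sumE //=; lia.
Qed.

Lemma compile_correct e : compiles e.
Proof.
elim: e => [c|i|a|a IHa b|a IHa b|a IHa b].
- exact: compiles_const.
- exact: compiles_var.
- exact: compiles_load.
- exact: compiles_add.
- exact: compiles_sub.
- exact: compiles_sum.
Qed.

(** * Polynomial bounds *)

Definition is_poly (F : nat -> nat) : Prop :=
  exists P : {poly nat}, forall n, F n = P.[n]%R.

Lemma is_poly_const c : is_poly (fun=> c).
Proof. by exists c%:P%R => n; rewrite hornerC. Qed.

Lemma is_poly_id : is_poly id.
Proof. by exists 'X%R => n; rewrite hornerX. Qed.

Lemma is_polyD F1 F2 : is_poly F1 -> is_poly F2 -> is_poly (fun n => F1 n + F2 n).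
Proof. by move=> [P PE] [Q QE]; exists (P + Q)%R => n; rewrite hornerD PE QE. Qed.

Lemma is_poly_succ : is_poly succn.
Proof. by exists ('X + 1)%R => n; rewrite hornerD hornerX hornerC natrE addn1. Qed.

Lemma is_polyM F1 F2 : is_poly F1 -> is_poly F2 -> is_poly (fun n => F1 n * F2 n).
Proof. by move=> [P PE] [Q QE]; exists (P * Q)%R => n; rewrite hornerM PE QE. Qed.

Lemma is_poly_comp F1 F2 : is_poly F1 -> is_poly F2 -> is_poly (fun n => F1 (F2 n)).
Proof. by move=> [P PE] [Q QE]; exists (P \Po Q)%R => n; rewrite horner_comp PE QE. Qed.

Lemma is_poly_value_bound e : is_poly (value_bound e).
Proof.
elim: e => [c|i|a _|a IHa b IHb|a IHa b _|a IHa b IHb] /=.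
- exact: is_poly_const.
- exact: is_poly_id.
- exact: is_poly_id.
- exact: is_polyD.
- exact: IHa.
exact: (is_polyM IHa (is_poly_comp IHb (is_polyD is_poly_id IHa))).
Qed.

Lemma is_poly_cost_bound e : is_poly (cost_bound e).
Proof.
have const c := is_poly_const c.
elim: e => [c|i|a IHa|a IHa b IHb|a IHa b IHb|a IHa b IHb] //=.
- exact: is_polyD.
- by apply: is_polyD IHa _; apply: is_polyD.
- by apply: is_polyD IHa _; apply: is_polyD.
have value_a := is_poly_value_bound a.
do !apply: is_polyD => //; apply: is_polyM => //; do !apply: is_polyD => //.
by apply: is_poly_comp IHb _; apply: is_polyD is_poly_id _.
Qed.

(** * Adjacency matrices by rank *)

Lemma map_enum_rank (T : finType) : [seq val (enum_rank x) | x <- enum T] = iota 0 #|T|.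
Proof.
apply: (@eq_from_nth _ 0) => [|i]; rewrite size_map -cardE ?size_iota // => lt_i.
rewrite nth_iota // (nth_map (enum_val (Ordinal lt_i))) -?cardE //.
by rewrite -[i in nth _ _ i]/(val (Ordinal lt_i)) -enum_val_nth enum_valK.
Qed.

Lemma nth_allpairs (S T U : Type) (f : S -> T -> U) x0 y0 z0 s t i j :
    i < size s -> j < size t ->
  nth z0 [seq f x y | x <- s, y <- t] (i * size t + j) = f (nth x0 s i) (nth y0 t j).
Proof.
elim: s i => // x s IHs [|i] lt_i lt_j /=; rewrite nth_cat size_map.
  by rewrite lt_j (nth_map y0).
by rewrite mulSn -addnA ltnNge leq_addr /= addKn; apply: IHs.
Qed.

Lemma enum_prodE (T1 T2 : finType) :
  enum {: T1 * T2} = [seq (x, y) | x <- enum T1, y <- enum T2].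
Proof. by rewrite [LHS]enumT [Finite.enum]unlock. Qed.

Lemma enum_rank_pair (T1 T2 : finType) (x : T1) (y : T2) :
  enum_rank (x, y) = enum_rank x * #|T2| + enum_rank y :> nat.
Proof.
set r := _ + _; have lt_x := ltn_ord (enum_rank x); have lt_y := ltn_ord (enum_rank y).
have lt_r : r < #|{: T1 * T2}|.
  rewrite card_prod; apply: leq_trans (leq_mul lt_x (leqnn _)).
  by rewrite mulSnr ltn_add2l.
rewrite -[RHS]/(val (Ordinal lt_r)); congr val; apply: (can_inj enum_valK).
rewrite enum_rankK (enum_val_nth (x, y)) enum_prodE /= /r [X in _ * X + _]cardE.
by rewrite (nth_allpairs _ x y) -?cardE // -!enum_val_nth !enum_rankK.
Qed.

Lemma enum_rank_ordE n (i : 'I_n) : enum_rank i = i :> nat.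
Proof. by rewrite enum_rank_ord. Qed.

Definition adjacency (G : graph) (k : nat) : nat := nth 0 (behead (encode G)) k.

Lemma adjacency_leq1 (G : graph) k : adjacency G k <= 1.
Proof.
rewrite /adjacency /=; set M := flatten _.
have /allP M_le1 : all (leq^~ 1) M.
  by apply/allP => x /allpairsP[[u v] /= [_ _ ->]]; apply: leq_b1.
by case: (ltnP k (size M)) => [/(mem_nth 0)/M_le1 | /(nth_default 0)->].
Qed.

Lemma adjacency_rank (G : graph) (u v : G) :
  adjacency G (enum_rank u * #|G| + enum_rank v) = adj u v.
Proof.
rewrite /adjacency /= {2}cardE (nth_allpairs _ u u) -?cardE //.
by rewrite -!enum_val_nth !enum_rankK.
Qed.

Lemma encode_by_rank (G : graph) (g : nat -> nat -> nat) :
    (forall u v : G, g (enum_rank u) (enum_rank v) = adj u v) ->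
  encode G = #|G| :: [seq g i j | i <- iota 0 #|G|, j <- iota 0 #|G|].
Proof.
move=> gE; congr (_ :: _); rewrite -map_enum_rank allpairs_mapl allpairs_mapr.
by apply: eq_allpairs => u v; rewrite gE.
Qed.

(** * Graph transformations given by expressions *)

Definition read_array : code :=
  for_loop 2 1
    (block (IRead (slot 3) :: rcons (cell_address 4 2) (IStore (slot 4) (slot 3)))).

Lemma runs_read_array s : reg s (slot 1) = size (inp s) ->
  runs read_array (size (inp s) * (5 + 4) + 5) s (fun s' =>
    [/\ reg s' (slot 0) = reg s (slot 0), out s' = out s &
        forall j, reg s' (cell j) =
          if j < size (inp s) then nth 0 (inp s) j else reg s (cell j)]).
Proof.
set M := inp s => size_M.
pose I k s' := [/\ reg s' (slot 0) = reg s (slot 0), inp s' = drop k M, out s' = out s &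
  forall j, reg s' (cell j) = if j < k then nth 0 M j else reg s (cell j)].
apply: (@runs_weaken _ _ _ _ (I (size M))) (leqnn _) _ => [|s' [? _ ? ?]] //.
apply: (runs_for (I := I)) => //
  [k s1 s2 [keptE inpE outE] [zeroE inp1E out1E arrayE]||
   k s1 lt_k kE size_M1 [zeroE inp1E out1E arrayE]].
- split; rewrite ?inpE ?outE ?out1E ?cats0 //; first by rewrite keptE ?kept_slot.
  by move=> j; rewrite keptE ?kept_cell.
- by split; rewrite ?drop0.
apply: (runs_block (l := [:: _; _; _; _; _])) => //.
have headE : head 0 (inp s1) = nth 0 M k by rewrite inp1E -nth0 nth_drop addn0.
rewrite /I /= !kE addn1 addnn -/(cell k) headE !regE; split=> //; split=> //.
  by rewrite inp1E -drop1 drop_drop add1n.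
move=> j; rewrite !regE ltnS leq_eqVlt; case: eqP => [-> //|_] /=.
by rewrite arrayE.
Qed.

(* Under the sum, the number of vertices is variable 1. *)
Definition order_square : expr := ESum (EVar 0) (EVar 1).

Definition read_graph : code :=
  block [:: IRead (slot 0)] ;; compile [:: slot 0] 1 order_square ;; read_array.

Definition read_time (n : nat) : nat :=
  1 + (cost_bound order_square n + (n * n * (5 + 4) + 5)).

Lemma runs_read_graph (G : graph) :
  runs read_graph (read_time #|G|) (init_config (encode G)) (fun s =>
    represents 1 [:: slot 0] (adjacency G) [:: #|G|] s /\ out s = [::]).
Proof.
set n := #|G|; set M := behead (encode G).
have size_M : size M = n * n by rewrite size_allpairs -cardE.
apply/runs_seq/(runs_block (l := [:: _])) => //; set s0 := exec_seq _ _.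
have repr0 : represents 1 [:: slot 0] (fun=> 0) [:: n] s0.
  by split=> [|k|]; rewrite /= ?kept_slot ?regE ?eqxx.
have bounded0 : bounded n (fun=> 0) [:: n] by split; rewrite //= leqnn.
apply/runs_seq/(compile_correct repr0 bounded0) => s1 E1.
rewrite /= sum_nat_const card_ord -size_M => size_inp.
have [_ cell1E [nE]] := represents_emits E1 repr0.
have inp1E : inp s1 = M by case: E1.
have out1E : out s1 = [::] by case: E1.
rewrite -inp1E in size_inp.
apply: runs_weaken (runs_read_array size_inp) _ _ => [|s [zeroE outE cellE]].
  by rewrite inp1E size_M.
split; last by rewrite outE out1E.
split=> [|j|]; rewrite /= ?kept_slot ?zeroE ?nE //.
rewrite cellE cell1E inp1E; case: ltnP => // le_j.
by rewrite /adjacency -/M nth_default.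
Qed.

Definition print_matrix (entry : expr) : code :=
  for_loop 2 1 (for_loop 3 1
    (compile [:: slot 2; slot 3; slot 0] 4 entry ;; block [:: IPrint (slot 4)])).

Definition print_time (N t : nat) : nat := N * (N * (t + 1 + 4) + 5 + 4) + 5.

Lemma runs_print_matrix entry m n N B s :
    represents 1 [:: slot 0] m [:: n] s -> reg s (slot 1) = N ->
    (forall i j, i < N -> j < N -> bounded B m [:: i; j; n]) ->
  runs (print_matrix entry) (print_time N (cost_bound entry B)) s (fun s' =>
    out s' = out s ++ [seq eval m [:: i; j; n] entry | i <- iota 0 N, j <- iota 0 N]).
Proof.
move=> repr orderE env_le.
pose print_row i := [seq eval m [:: i; j; n] entry | j <- iota 0 N].
pose matrix_text := flatten [seq print_row i | i <- iota 0 N].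
apply: (runs_weaken (Q := emits 2 matrix_text s) _ (leqnn _)) => [|s' []] //.
apply: runs_for_emits => // i s1 y1 lt_i iE E1; rewrite -[print_row i]flatten_map1.
apply: runs_for_emits => // [|j s2 y2 lt_j jE E2]; first by rewrite (emits_reg E1).
have repr2 : represents 4 [:: slot 2; slot 3; slot 0] m [:: i; j; n] s2.
  apply: represents_cons => //; first by rewrite (emits_reg E2) ?kept_slot.
  apply: represents_cons => //; apply: (@represents_leq 1) => //.
  apply: represents_emits (emits_leq _ E2) _ => //.
  exact: represents_emits (emits_leq _ E1) repr.
apply/runs_seq/(compile_correct repr2 (env_le i j lt_i lt_j)) => s3 E3 entryE.
apply: (runs_block (l := [:: _])) => //=.
rewrite -[[:: _]]cat0s; apply: emits_trans E3 _.
by split=> //=; rewrite entryE cats1.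
Qed.

Definition graph_code (order_expr adj_expr : expr) : code :=
  read_graph ;; compile [:: slot 0] 1 order_expr ;; block [:: IPrint (slot 1)] ;;
  print_matrix adj_expr.

Definition graph_time (order_expr adj_expr : expr) (n : nat) : nat :=
  let N := value_bound order_expr n.+1 in
  read_time n + (cost_bound order_expr n.+1 +
    (1 + print_time N (cost_bound adj_expr (n.+1 + N + N)))).

Lemma is_poly_graph_time order_expr adj_expr : is_poly (graph_time order_expr adj_expr).
Proof.
have N_poly := is_poly_comp (is_poly_value_bound order_expr) is_poly_succ.
have order_poly := is_poly_comp (is_poly_cost_bound order_expr) is_poly_succ.
have env_poly := is_polyD (is_polyD is_poly_succ N_poly) N_poly.
have adj_poly := is_poly_comp (is_poly_cost_bound adj_expr) env_poly.
have square_poly := is_poly_cost_bound order_square.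
rewrite /graph_time /read_time /print_time.
by do ?[exact: square_poly | exact: order_poly | exact: adj_poly | exact: N_poly
  | exact: is_poly_id | exact: is_poly_const | apply: is_polyD | apply: is_polyM].
Qed.

Section PolytimeExpr.

Variables (f : graph -> graph) (order_expr adj_expr : expr).
Hypothesis order_correct : forall G,
  eval (adjacency G) [:: #|G|] order_expr = #|f G|.
Hypothesis adj_correct : forall (G : graph) (u v : f G),
  eval (adjacency G) [:: val (enum_rank u); val (enum_rank v); #|G|] adj_expr = adj u v.

Lemma runs_graph_code (G : graph) :
  runs (graph_code order_expr adj_expr) (graph_time order_expr adj_expr #|G|)
    (init_config (encode G)) (fun s => out s = encode (f G)).
Proof.
set n := #|G|; set N := value_bound order_expr n.+1.
have n_bounded : bounded n.+1 (adjacency G) [:: n].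
  by split=> [k|]; rewrite /= ?leqnSn // (leq_trans (adjacency_leq1 G k)).
have le_N : #|f G| <= N by rewrite -order_correct leq_value_bound.
apply/runs_seq/(runs_weaken (runs_read_graph G) (leqnn _)) => s0 [repr0 out0].
apply/runs_seq/(compile_correct repr0 n_bounded) => s1 E1.
rewrite order_correct => orderE; have repr1 := represents_emits E1 repr0.
have out1 : out s1 = [::] by case: E1 => _ _ ->; rewrite out0.
apply/runs_seq/(runs_block (l := [:: _])) => //; set s2 := exec_seq _ _.
have repr2 : represents 1 [:: slot 0] (adjacency G) [:: n] s2 by [].
apply: runs_weaken (runs_print_matrix (B := n.+1 + N + N) repr2 orderE _) _ _.
- move=> i j lt_i lt_j; apply: bounded_cons (ltnW (leq_trans lt_i le_N)).
  exact: bounded_cons (ltnW (leq_trans lt_j le_N)).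
- by rewrite leq_add2r leq_mul // !leq_add2r leq_mul.
move=> s' ->; pose g i j := eval (adjacency G) [:: i; j; n] adj_expr.
by rewrite (encode_by_rank (G := f G) (g := g) (@adj_correct G)) /= out1 orderE.
Qed.

Lemma polytime_expr : polytime f.
Proof.
have [P PE] := is_poly_graph_time order_expr adj_expr.
exists (graph_code order_expr adj_expr 0), P => G; rewrite -PE.
exact: runs_halts (runs_graph_code G).
Qed.

End PolytimeExpr.

(** * Derived expressions *)

Declare Scope expr_scope.
Delimit Scope expr_scope with E.
Bind Scope expr_scope with expr.

Coercion EConst : nat >-> expr.
Notation "''x_' i" := (EVar i)
  (at level 8, i at level 2, format "''x_' i") : expr_scope.
Notation "a + b" := (EAdd a b) : expr_scope.
Notation "a - b" := (ESub a b) : expr_scope.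

Fixpoint shift (c : nat) (e : expr) : expr :=
  match e with
  | EConst k => EConst k
  | EVar i => EVar (bump c i)
  | ELoad a => ELoad (shift c a)
  | EAdd a b => EAdd (shift c a) (shift c b)
  | ESub a b => ESub (shift c a) (shift c b)
  | ESum a b => ESum (shift c a) (shift c.+1 b)
  end.

Definition emul (a b : expr) : expr := ESum a (shift 0 b).
Notation "a * b" := (emul a b) : expr_scope.

Definition enot (a : expr) : expr := (1 - a)%E.

Definition eltn (a b : expr) : expr := enot (1 - (b - a)).
Notation "a < b" := (eltn a b) : expr_scope.

Definition edist (a b : expr) : expr := ((a - b) + (b - a))%E.

Definition eeq (a b : expr) : expr := enot (edist a b).
Notation "a == b" := (eeq a b) : expr_scope.

Definition eor (a b : expr) : expr := (0 < a + b)%E.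

Definition edivn (a b : expr) : expr :=
  ESum a (enot (shift 0 a < ('x_0 + 1) * shift 0 b)).
Notation "a %/ b" := (edivn a b) : expr_scope.

Definition emodn (a b : expr) : expr := (a - (a %/ b) * b)%E.
Notation "a %% b" := (emodn a b) : expr_scope.

Definition eprime (a : expr) : expr :=
  enot (ESum (a - 2) (shift 0 a %% ('x_0 + 2) == 0)).

Definition enext_prime (a : expr) : expr :=
  (a + ESum (2 * (a * a) + 1)
         (enot (ESum ('x_0 + 1) (eprime (shift 0 (shift 0 a) + 'x_0)))))%E.

Lemma prime_sumE n : 1 < n ->
  prime n = (\sum_(k < n - 2) (n %% (k + 2) == 0) == 0).
Proof.
move=> n_gt1; rewrite sum_nat_eq0; apply/idP/forallP => [n_pr k | no_dvd].
  rewrite eqb0; apply/negP => /(primeP n_pr).2/orP[] /eqP; first by lia.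
  by have := ltn_ord k; lia.
apply: contraT => /primePn[|[d /andP[d_gt1 d_lt] d_dvd]]; first by lia.
have lt_d : d - 2 < n - 2 by lia.
by have := no_dvd (Ordinal lt_d); rewrite /= subnK // -/(d %| n) d_dvd.
Qed.

Lemma find_iotaE (a : pred nat) N :
  find a (iota 0 N) = \sum_(k < N) (\sum_(j < k.+1) a j == 0).
Proof.
have sum_eq0 K : (\sum_(j < K) a j == 0) = ~~ has a (iota 0 K).
  rewrite sum_nat_eq0; apply/forallP/hasPn => none j.
    by rewrite mem_iota => lt_j; have := none (Ordinal lt_j); rewrite eqb0.
  by rewrite eqb0 none // mem_iota /= add0n.
elim: N => [|N IHN]; first by rewrite big_ord0.
rewrite big_ord_recr [in RHS]/= -IHN sum_eq0 -addn1 iotaD find_cat has_cat size_iota.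
case: ifP => [_ | /negbT/hasNfind->]; first by rewrite addn0.
by rewrite size_iota /= orbF; case: (a N).
Qed.

Lemma evalE m env :
  (forall c, eval m env (EConst c) = c) * (forall i, eval m env ('x_i) = nth 0 env i) *
  (forall a, eval m env (ELoad a) = m (eval m env a)) *
  (forall a b, eval m env (a + b) = eval m env a + eval m env b) *
  (forall a b, eval m env (a - b) = eval m env a - eval m env b) *
  (forall a b, eval m env (ESum a b) = \sum_(k < eval m env a) eval m (val k :: env) b).
Proof. by []. Qed.

Lemma eval_shift m env1 x env2 a :
  eval m (env1 ++ x :: env2) (shift (size env1) a) = eval m (env1 ++ env2) a.
Proof.
elim: a env1 => [c|i|a IHa|a IHa b IHb|a IHa b IHb|a IHa b IHb] env1 //=.
- rewrite !nth_cat /bump; case: (ltnP i (size env1)) => [-> //|le_i].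
  by rewrite ltnNge leqW // subSn.
- by rewrite IHa.
- by rewrite IHa IHb.
- by rewrite IHa IHb.
by rewrite IHa; apply: eq_bigr => k _; apply: (IHb (val k :: env1)).
Qed.

Lemma eval_weaken m x env a : eval m (x :: env) (shift 0 a) = eval m env a.
Proof. exact: (eval_shift m [::]). Qed.

Section Eval.

Variables (m : nat -> nat) (env : seq nat).
Implicit Types a b : expr.
Local Notation ev := (eval m env).

Lemma eval_mul a b : ev (a * b) = ev a * ev b.
Proof.
rewrite evalE (eq_bigr (fun=> ev b)) ?sum_nat_const ?card_ord // => k _.
exact: eval_weaken.
Qed.

Lemma eval_not a : ev (enot a) = (ev a == 0).
Proof. by rewrite !evalE; case: (ev a) => [|[]]. Qed.

Lemma eval_ltn a b : ev (a < b) = (ev a < ev b).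
Proof. by rewrite eval_not !evalE; lia. Qed.

Lemma eval_dist a b : ev (edist a b) = (ev a - ev b) + (ev b - ev a).
Proof. by []. Qed.

Lemma eval_eq a b : ev (a == b) = (ev a == ev b).
Proof. by rewrite eval_not eval_dist; lia. Qed.

Lemma eval_or a b : ev (eor a b) = (0 < ev a) || (0 < ev b).
Proof. by rewrite eval_ltn !evalE addn_gt0. Qed.

End Eval.

Lemma eval_divn m env a b : 0 < eval m env b ->
  eval m env (a %/ b) = eval m env a %/ eval m env b.
Proof.
move=> b_gt0; rewrite -[RHS](minn_idPr (leq_div _ _)) -sum_nat_ltn evalE.
apply: eq_bigr => k _; rewrite eval_not eval_ltn eval_mul !evalE !eval_weaken addn1.
by rewrite eqb0 -leqNgt -leq_divRL.
Qed.

Lemma eval_modn m env a b : 0 < eval m env b ->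
  eval m env (a %% b) = eval m env a %% eval m env b.
Proof.
move=> b_gt0; rewrite /emodn evalE eval_mul eval_divn //.
by rewrite {1}(divn_eq (eval m env a) (eval m env b)) addKn.
Qed.

Lemma eval_prime m env a : 1 < eval m env a ->
  eval m env (eprime a) = prime (eval m env a).
Proof.
move=> a_gt1; rewrite /eprime eval_not prime_sumE // !evalE.
congr (nat_of_bool (_ == 0)); apply: eq_bigr => k _.
by rewrite eval_eq eval_modn !evalE ?eval_weaken // addn2.
Qed.

Lemma eval_next_prime m env a : 1 < eval m env a ->
  eval m env (enext_prime a) = next_prime (eval m env a).
Proof.
move=> a_gt1; rewrite /next_prime find_iotaE /enext_prime 3!evalE !eval_mul !evalE.
rewrite addn1 mul2n mulnn; congr (_ + _); apply: eq_bigr => k _.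
rewrite eval_not !evalE addn1; congr (nat_of_bool (_ == 0)); apply: eq_bigr => j _.
by rewrite eval_prime !evalE !eval_weaken // (leq_trans a_gt1) ?leq_addr.
Qed.

(** * The lifted graph in polynomial time *)

Lemma natr_dist_sqr (R : comPzRingType) i j :
  (((i - j + (j - i)) ^ 2)%:R = (j%:R - i%:R) ^+ 2 :> R)%R.
Proof.
rewrite natrX natrD; have [le_ij | /ltnW le_ji] := leqP i j.
  by rewrite (eqP le_ij) add0r natrB.
by rewrite (eqP le_ji) addr0 natrB // -sqrrN opprB.
Qed.

Lemma parabola_Fp p (x y : 'F_p * 'F_p) : prime p -> parabola 1%R x y =
  (val x.1 != val y.1) && (val y.2 == (x.2 + (x.1 - y.1 + (y.1 - x.1)) ^ 2) %% p).
Proof.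
move=> p_pr; rewrite /parabola -val_eqE -[X in _ && X]val_eqE; congr (_ && (_ == _)).
by rewrite mul1r -val_Fp_nat // natrD natr_dist_sqr !natr_Zp.
Qed.

Definition eparabola (p x1 x2 y1 y2 : expr) : expr :=
  enot (x1 == y1) * (y2 == (x2 + edist x1 y1 * edist x1 y1) %% p).

Lemma eval_parabola p m env ep ex1 ex2 ey1 ey2 (x y : 'F_p * 'F_p) : prime p ->
    eval m env ep = p -> eval m env ex1 = x.1 -> eval m env ex2 = x.2 ->
    eval m env ey1 = y.1 -> eval m env ey2 = y.2 ->
  eval m env (eparabola ep ex1 ex2 ey1 ey2) = parabola 1%R x y.
Proof.
move=> p_pr pE x1E x2E y1E y2E; rewrite parabola_Fp //.
rewrite eval_mul eval_not !eval_eq x1E y1E y2E eval_modn pE ?prime_gt0 //.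
by rewrite evalE eval_mul eval_dist x1E y1E x2E mulnn eqb0 mulnb.
Qed.

(* A vertex (u, (x1, x2)) has rank (rank u * p + x1) * p + x2. *)
Definition earc (p i j : expr) : expr :=
  (i %/ p %/ p < j %/ p %/ p) *
  eparabola p (i %/ p %% p) (i %% p) (j %/ p %% p) (j %% p).

Section LiftRank.

Variables (p : nat) (T : finType) (m : nat -> nat) (env : seq nat) (ep ei : expr).
Variable a : T * ('F_p * 'F_p).
Hypothesis p_pr : prime p.
Hypothesis pE : eval m env ep = p.
Hypothesis iE : eval m env ei = enum_rank a.

Lemma enum_rank_Fp2 : enum_rank a = (enum_rank a.1 * p + a.2.1) * p + a.2.2 :> nat.
Proof.
case: a => u [x1 x2]; rewrite !enum_rank_pair !enum_rank_ordE card_prod card_Fp //=.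
by rewrite mulnA mulnDl addnA.
Qed.

Lemma ltn_Fp (x : 'F_p) : x < p.
Proof. by rewrite -[ltnRHS](Fp_cast p_pr) ltn_ord. Qed.

Lemma eval_rank_snd : eval m env (ei %% ep) = a.2.2.
Proof.
by rewrite eval_modn pE ?prime_gt0 // iE enum_rank_Fp2 modnMDl modn_small ?ltn_Fp.
Qed.

Lemma eval_rank_div : eval m env (ei %/ ep) = enum_rank a.1 * p + a.2.1.
Proof.
rewrite eval_divn pE ?prime_gt0 // iE enum_rank_Fp2 divnMDl ?prime_gt0 //.
by rewrite divn_small ?addn0 ?ltn_Fp.
Qed.

Lemma eval_rank_fst : eval m env (ei %/ ep %% ep) = a.2.1.
Proof.
by rewrite eval_modn pE ?prime_gt0 // eval_rank_div modnMDl modn_small ?ltn_Fp.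
Qed.

Lemma eval_rank_base : eval m env (ei %/ ep %/ ep) = enum_rank a.1.
Proof.
rewrite eval_divn pE ?prime_gt0 // eval_rank_div divnMDl ?prime_gt0 //.
by rewrite divn_small ?addn0 ?ltn_Fp.
Qed.

End LiftRank.

Lemma eval_arc (G : graph) p m env ep ei ej (a b : G * ('F_p * 'F_p)) : prime p ->
    eval m env ep = p -> eval m env ei = enum_rank a -> eval m env ej = enum_rank b ->
  eval m env (earc ep ei ej) = blowup_arc (parabola 1%R) a b.
Proof.
move=> p_pr pE iE jE; rewrite eval_mul eval_ltn /blowup_arc.
rewrite (eval_rank_base p_pr pE iE) (eval_rank_base p_pr pE jE).
rewrite (@eval_parabola p _ _ _ _ _ _ _ a.2 b.2) ?mulnb //.
- exact: eval_rank_fst.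
- exact: eval_rank_snd.
- exact: eval_rank_fst.
- exact: eval_rank_snd.
Qed.

Definition eside (n : expr) : expr := enext_prime (n * n + 4 * n + 8).

Lemma eval_side m env en : eval m env (eside en) = side (eval m env en).
Proof.
have boundE : eval m env (en * en + 4 * en + 8) = side_bound (eval m env en).
  by rewrite 2!evalE !eval_mul !evalE.
by rewrite eval_next_prime boundE //; apply: leq_trans (leq_addl _ 8).
Qed.

Definition lift_order_expr : expr := 'x_0 * (eside 'x_0 * eside 'x_0).

Definition lift_adj_expr : expr :=
  (let i := 'x_0 in let j := 'x_1 in let n := 'x_2 in let p := eside n in
   ELoad (i %/ p %/ p * n + j %/ p %/ p) * eor (earc p i j) (earc p j i))%E.

Lemma polytime_lift_graph : polytime lift_graph.
Proof.
apply: (@polytime_expr _ lift_order_expr lift_adj_expr) => [G | G a b].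
  by rewrite !eval_mul eval_side card_lift_graph mulnn.
have p_pr := side_prime #|G|.
set m := adjacency G; set env := [:: _; _; _].
have pE : eval m env (eside 'x_2) = side #|G| by apply: eval_side.
have iE : eval m env 'x_0 = enum_rank a by [].
have jE : eval m env 'x_1 = enum_rank b by [].
rewrite eval_mul eval_or (eval_arc p_pr pE iE jE) (eval_arc p_pr pE jE iE).
rewrite 2!evalE eval_mul.
rewrite (eval_rank_base p_pr pE iE) (eval_rank_base p_pr pE jE).
by rewrite /= /m adjacency_rank !lt0b mulnb.
Qed.

Theorem theorem8 :
  exists f : graph -> graph,
    polytime f /\
    forall (G : graph) (Delta : nat), max_degree G = Delta ->
      triangle_free (f G) /\ rel_IS (f G) = rel_IS G.
Proof.
exists lift_graph; split; first exact: polytime_lift_graph.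
by move=> G _ _; split; [apply: lift_graph_triangle_free | apply: rel_IS_lift_graph].
Qed.
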